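(* Let $H$ be a hypergraph and $p\in(0,1)$. If every edge in $H$ is flammable with respect to $p$, then $b_{L,p}(H)\leq b_L(H)$ and $b_p(H)\leq b(H)$.
   Context: A hypergraph $H=(V(H),E(H))$ has a finite nonempty vertex set and a finite collection $E(H)$ of subsets of $V(H)$ called edges (parallel edges allowed). An edge $e$ is non-flammable with respect to $p$ if $\lceil p|e|\rceil=|e|$, and flammable otherwise. Given a propagation rule, the burning game is: let $F_0=\emptyset$ and $F_r$ be the set of burned vertices at the end of round $r$; in each round $r\geq 1$, simultaneously, vertices catch fire by propagation from $F_{r-1}$ (no propagation in round 1), and a player chooses a vertex $u_r\notin F_{r-1}$ (a source) and sets it on fire; burned vertices stay burned. A burning sequence is a sequence $(u_1,\ldots,u_k)$ of such sources after which every vertex is on fire at the end of round $k$. In the lazy game, $S\subseteq V(H)$ is a lazy burning set if, setting all of $S$ on fire at once and then repeatedly applying the propagation rule, every vertex eventually catches fire. Proportion-based rule (proportion $p$): if at least $\lceil p|e|\rceil$ vertices of an edge $e$ are on fire, then at the next step all vertices of $e$ catch fire; $b_p(H)$ and $b_{L,p}(H)$ denote the minimum length of a burning sequence and minimum size of a lazy burning set under this rule. Original rule: a vertex $v$ catches fire at the next step if there is an edge $\{v,u_1,\ldots,u_k\}$ with all of $u_1,\ldots,u_k$ on fire; $b(H)$ and $b_L(H)$ denote the minimum length of a burning sequence and minimum size of a lazy burning set under this rule. *)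

(* Defs.v *)
From HB Require Import structures.
From mathcomp Require Import all_boot all_order all_algebra.
From mathcomp Require Import boolp reals.

Set Implicit Arguments.
Unset Strict Implicit.
Unset Printing Implicit Defensive.

Import Order.TTheory GRing.Theory Num.Theory.

(* The edges form a list, so that parallel edges are allowed; neither the order
   of the list nor the size of the edges is restricted. *)
Record hypergraph := Hypergraph {
  vertex : finType;
  edges : seq {set vertex};
  vertex_nonempty : 0 < #|vertex|
}.

(* A propagation rule maps the set of vertices on fire to the set of vertices
   that catch fire at the next step; the former also stay on fire. *)
Definition propagation_rule (V : finType) := {set V} -> {set V}.

Section Burning.
Variables (V : finType) (rule : propagation_rule V).

(* [fire u r] is the set F_r when the successive sources are listed in [u]; the
   source of round [r.+1] is the entry of [u] of index [r], counted from 0. *)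
Fixpoint fire (u : seq V) (r : nat) : {set V} :=
  if r is r'.+1 then
    fire u r'
      :|: (if r' is 0 then set0 else rule (fire u r'))
      :|: [set v | onth u r' == Some v]
  else set0.

Definition legal_sources (k : nat) (u : k.-tuple V) : bool :=
  [forall r : 'I_k, tnth u r \notin fire u r].

Definition burning_sequence (k : nat) (u : k.-tuple V) : bool :=
  legal_sources u && (fire u k == [set: V]).

Definition lazy_burning_set (S : {set V}) : Prop :=
  exists n : nat, iter n (fun F => F :|: rule F) S = [set: V].

Lemma fire_rcons (u : seq V) (v : V) (r : nat) :
  r <= size u -> fire (rcons u v) r = fire u r.
Proof.
elim: r => //= r IHr lt_r; rewrite IHr 1?ltnW //; congr (_ :|: _).
by apply/setP=> w; rewrite !inE -cats1 onth_cat lt_r.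
Qed.

Lemma burning_sequence_or_play (n : nat) :
  (exists k, [exists u : k.-tuple V, burning_sequence u]) \/
  (exists u : n.-tuple V, legal_sources u /\ n <= #|fire u n|).
Proof.
elim: n => [|n [|[u [legal_u le_n]]]]; [|by left|].
  by right; exists [tuple]; split=> //; apply/forallP; case.
have [fireT|] := boolP (fire u n == [set: V]).
  by left; exists n; apply/existsP; exists u; rewrite /burning_sequence legal_u.
rewrite eqEsubset subsetT /= => /subsetPn[v _ v_notin]; right.
exists [tuple of rcons u v]; split.
  apply/forallP=> r; have le_r : r <= n by rewrite -ltnS.
  rewrite fire_rcons ?size_tuple // (tnth_nth v) /= nth_rcons size_tuple.
  case: ltngtP le_r => // [lt_r|->] _ //.
  by have /forallP/(_ (Ordinal lt_r)) := legal_u; rewrite (tnth_nth v).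
have /subset_leq_card : v |: fire u n \subset fire (rcons u v) n.+1.
  rewrite /= fire_rcons ?size_tuple // subUset sub1set !inE.
  rewrite -cats1 onth_cat size_tuple ltnn subnn eqxx !orbT /=.
  by rewrite -setUA subsetUl.
by apply: leq_trans; rewrite cardsU1 v_notin.
Qed.

Lemma exists_burning_length :
  exists k, [exists u : k.-tuple V, burning_sequence u].
Proof.
have [//|[u [_ lt_card]]] := burning_sequence_or_play #|V|.+1.
by have := leq_trans lt_card (max_card _); rewrite ltnn.
Qed.

Lemma exists_lazy_burning_size :
  exists k, [exists S : {set V}, `[< lazy_burning_set S >] && (#|S| == k)].
Proof.
exists #|[set: V]|; apply/existsP; exists [set: V].
by rewrite eqxx andbT; apply/asboolP; exists 0.
Qed.

Definition burning_number : nat := ex_minn exists_burning_length.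

Definition lazy_burning_number : nat := ex_minn exists_lazy_burning_size.

End Burning.

Local Open Scope ring_scope.

Definition nonflammable (R : realType) (V : finType) (p : R) (e : {set V}) :
    bool :=
  Num.ceil (p * #|e|%:R) == #|e|%:Z.

Definition flammable (R : realType) (V : finType) (p : R) (e : {set V}) :
    bool :=
  ~~ nonflammable p e.

Definition proportion_rule (R : realType) (p : R) (H : hypergraph) :
    propagation_rule (vertex H) :=
  fun F => [set v | has (fun e : {set vertex H} =>
    (v \in e) && (Num.ceil (p * #|e|%:R) <= #|e :&: F|%:Z)) (edges H)].

Definition original_rule (H : hypergraph) : propagation_rule (vertex H) :=
  fun F => [set v | has (fun e : {set vertex H} =>
    (v \in e) && (e :\ v \subset F)) (edges H)].

Arguments proportion_rule {R} p H F.
Arguments original_rule : clear implicits.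

Definition b_prop (R : realType) (p : R) (H : hypergraph) : nat :=
  burning_number (proportion_rule p H).

Definition bL_prop (R : realType) (p : R) (H : hypergraph) : nat :=
  lazy_burning_number (proportion_rule p H).

Definition b (H : hypergraph) : nat := burning_number (original_rule H).

Definition bL (H : hypergraph) : nat := lazy_burning_number (original_rule H).

(* Main.v *)
Require Import Defs.
From mathcomp Require Import all_boot all_order all_algebra.
From mathcomp Require Import boolp reals.

Set Implicit Arguments.
Unset Strict Implicit.
Unset Printing Implicit Defensive.

Import Order.TTheory GRing.Theory Num.Theory.

(** A flammable edge [e] has threshold at most [|e| - 1], so whenever the
    original rule burns a vertex the proportion-based rule burns it too, from any
    larger set.  The lazy inequality follows by iterating.  For the game, a source
    of the original sequence may already be on fire under the faster rule; it is
    then replaced by an arbitrary unburned vertex, and if there is none the game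
    is already over. *)

Lemma legal_sources_rcons (V : finType) (rule : propagation_rule V)
    (n : nat) (w : n.-tuple V) (v : V) :
  legal_sources rule w -> v \notin fire rule w n ->
  legal_sources rule [tuple of rcons w v].
Proof.
move=> /forallP legal_w v_new; apply/forallP=> r.
have le_r : r <= n by rewrite -ltnS.
rewrite fire_rcons ?size_tuple // (tnth_nth v) /= nth_rcons size_tuple.
case: ltngtP le_r => // [lt_r|->] _ //.
by have := legal_w (Ordinal lt_r); rewrite (tnth_nth v).
Qed.

Section DominatedRule.
Context {V : finType} {rule1 rule2 : propagation_rule V}.
(** Nested sets, rather than one common set, are compared so that the inclusion passes from each
    step to the next. *)
Hypothesis rule_le : forall A B : {set V}, A \subset B -> rule1 A \subset rule2 B.

Lemma lazy_burning_set_dominated (S : {set V}) :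
  lazy_burning_set rule1 S -> lazy_burning_set rule2 S.
Proof.
case=> n burn1; exists n; apply/eqP; rewrite eqEsubset subsetT /= -burn1.
by elim: n {burn1} => //= n IHn; rewrite setUSS // rule_le.
Qed.

Lemma lazy_burning_number_dominated :
  lazy_burning_number rule2 <= lazy_burning_number rule1.
Proof.
rewrite /lazy_burning_number; case: ex_minnP => m _ min_m.
case: ex_minnP => k /existsP[S /andP[/asboolP burnS cardS]] _.
apply: min_m; apply/existsP; exists S; rewrite cardS andbT; apply/asboolP.
exact: lazy_burning_set_dominated.
Qed.

(** The first alternative is a game won early under [rule2]: once every vertex burns there is no
    legal source, so the sequence cannot be prolonged to length [n]. *)
Lemma fire_dominated (u : seq V) (n : nat) :
  (exists2 m, m <= n & exists w : m.-tuple V, burning_sequence rule2 w) \/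
  (exists w : n.-tuple V,
     legal_sources rule2 w /\ fire rule1 u n \subset fire rule2 w n).
Proof.
elim: n => [|n [[m le_m burn_w]|[w [legal_w sub_w]]]].
- by right; exists [tuple]; split; [apply/forallP; case|].
- by left; exists m => //; apply: leqW.
have [burnT|] := boolP (fire rule2 w n == [set: V]).
  by left; exists n => //; exists w; rewrite /burning_sequence legal_w.
rewrite eqEsubset subsetT /= => /subsetPn[x _ x_new]; right.
(* [v] is the source [u] prescribes if it is still unburned, and the spare vertex [x] if that source
   already burns or [u] has no entry of index [n]. *)
have [v v_new src_v] : exists2 v, v \notin fire rule2 w n &
    forall y, onth u n = Some y -> y \in v |: fire rule2 w n.
  case: (onth u n) => [y|]; last by exists x.
  have [y_old|y_new] := boolP (y \in fire rule2 w n).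
    by exists x => // _ [<-]; rewrite setU1r.
  by exists y => // _ [<-]; rewrite setU11.
exists [tuple of rcons w v]; split; first exact: legal_sources_rcons.
rewrite /= fire_rcons ?size_tuple //.
have -> : [set y | onth (rcons w v) n == Some y] = [set v].
  apply/setP=> y; rewrite !inE -cats1 onth_cat size_tuple ltnn subnn /=.
  by rewrite eq_sym.
rewrite !subUset; apply/andP; split; first (apply/andP; split).
- by rewrite -setUA subsetU // sub_w.
(* Replacing the tuple by its underlying sequence frees [n] for case analysis: round 1 has no
   propagation, and later rounds use [rule_le]. *)
- move: (tval w) sub_w => s; case: (n) => [|n'] sub_s; first exact: sub0set.
  by do 2!rewrite subsetU //; rewrite rule_le ?orbT.
- apply/subsetP=> y; rewrite inE => /eqP /src_v.
  by rewrite !inE => /orP[->|->]; rewrite ?orbT.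
Qed.

Lemma burning_number_dominated : burning_number rule2 <= burning_number rule1.
Proof.
rewrite /burning_number; case: ex_minnP => m _ min_m.
case: ex_minnP => k /existsP[u /andP[_ /eqP fire_u]] _.
have [[n le_n [w burn_w]]|[w [legal_w]]] := fire_dominated u k.
  by apply: leq_trans le_n; apply: min_m; apply/existsP; exists w.
rewrite fire_u => sub_w; apply: min_m; apply/existsP; exists w.
by rewrite /burning_sequence legal_w eqEsubset subsetT.
Qed.

End DominatedRule.

Local Open Scope ring_scope.

(** Since [p <= 1], the integer [#|e|] bounds [p * #|e|] and hence its ceiling; flammability
    excludes equality. *)
Lemma flammable_threshold (R : realType) (V : finType) (p : R) (e : {set V}) :
  p <= 1 -> flammable p e -> Num.ceil (p * #|e|%:R) < #|e|%:Z.
Proof.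
move=> p_le1 flam; rewrite lt_neqAle; apply/andP; split; first exact: flam.
rewrite ceil_le_int.
by rewrite -[leRHS]mul1r ler_wpM2r ?ler0n.
Qed.

Lemma original_rule_sub_proportion (R : realType) (p : R) (H : hypergraph)
    (A B : {set vertex H}) :
  p <= 1 -> (forall e, e \in edges H -> flammable p e) -> A \subset B ->
  original_rule H A \subset proportion_rule p H B.
Proof.
move=> p_le1 flam subAB; apply/subsetP=> v; rewrite !inE.
case/hasP=> e eH /andP[ve sub_e]; apply/hasP; exists e => //; rewrite ve /=.
(* All of [e] except possibly [v] lies in [B]. The strict threshold bound absorbs this one missing
   vertex, as both sides are integers. *)
have card_e : (#|e| <= #|e :&: B|.+1)%N.
  rewrite (cardsD1 v e) ve add1n ltnS subset_leq_card // subsetI subD1set.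
  exact: subset_trans subAB.
have := lt_le_trans (flammable_threshold p_le1 (flam e eH)) _.
by move=> /(_ (#|e :&: B|.+1)%:Z card_e); rewrite -addn1 PoszD ltzD1.
Qed.

Theorem theorem2p26 (R : realType) (H : hypergraph) (p : R)
    (hp0 : 0 < p) (hp1 : p < 1)
    (hflam : forall e : {set vertex H}, e \in edges H -> flammable p e) :
  (bL_prop p H <= bL H)%N /\ (b_prop p H <= b H)%N.
Proof.
have rule_le (A B : {set vertex H}) :
    A \subset B -> original_rule H A \subset proportion_rule p H B.
  by apply: original_rule_sub_proportion hflam; apply: ltW.
split; first exact: lazy_burning_number_dominated.
exact: burning_number_dominated.
Qed.
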